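(* Let $n\ge 1$, let $X_{0-}^1,\dots,X_{0-}^n\ge 0$ be $\mathcal{F}_{0-}$-measurable initial conditions, let $c_1,\dots,c_n\ge 0$ be constants, let $Q=(q_{ij})_{i,j=1}^n$ be a matrix with non-negative entries and $q_{ii}=0$ for $1\le i\le n$, and let $Z=(Z^1,\dots,Z^n)$ be a vector of $\mathbb{F}$-adapted jump processes, each having almost surely finitely many jumps in any bounded interval. Consider the system of equations $$X_t^i=X_{0-}^i+c_it-Z_t^i+L_t^i-\sum_{j\neq i}q_{ij}L_t^j,\qquad L_t^i=\sup_{s\le t}\Big(X_{0-}^i+c_is-Z_s^i-\sum_{j\neq i}q_{ij}L_s^j\Big)_-,\qquad 1\le i\le n. \quad (\ast)$$ Define the cone $C=\{u\in\mathbb{R}^n: u\ge 0,\ u^\top(I-Q)\le 0\}$ and its dual cone $C^*=\{y\in\mathbb{R}^n: u^\top y\ge 0 \text{ for all } u\in C\}$. Let $(X,L)$ be a solution of $(\ast)$ on an interval $[0,\tau)$, where $\tau$ is a (possibly random) finite time and the left limits $X_{\tau-}$ and $L_{\tau-}$ exist in $\mathbb{R}^n$. Then $(X,L)$ can be extended to a solution of $(\ast)$ on $[0,\tau]$ if and only if $X_{\tau-}-\Delta Z_\tau\in C^*$. Moreover, when $X_{\tau-}-\Delta Z_\tau\in C^*$, there exists a unique minimal $\Delta L_\tau\in\mathbb{R}^n_+$, with respect to the partial order $\ge$ on $\mathbb{R}_+^n$, such that $L_\tau=L_{\tau-}+\Delta L_\tau$ gives an extension of $(X,L)$ to a solution of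 $(\ast)$ on $[0,\tau]$.
   Context: Fix a probability space $(\Omega,\mathcal{F},\mathbb{P})$ with a filtration $\mathbb{F}=(\mathcal{F}_t)_{t\ge 0-}$ satisfying the usual hypotheses. The time index set is $\{0-\}\cup[0,\infty)$, where the point $0-$ is prepended before $0$ to allow for jumps at the initial time (the left limit of a process at time $0$ is its value at $0-$); suprema over $s\le t$ include $s=0-$, at which the drift term $c_is$ is $0$. All stochastic processes are càdlàg. The jump of a process $A$ at time $t$ is $\Delta A_t:=A_t-A_{t-}$. A jump process is one that is constant between its jumps (for instance, a compound Poisson process). For $a\in\mathbb{R}$, $(a)_-:=-\min(0,a)$. For $x,y\in\mathbb{R}^n$ (column or row vectors), $x\ge y$ means $x_i\ge y_i$ for all $1\le i\le n$, and $x\le y$ means $y\ge x$. $\mathbb{R}^n_+=\{x\in\mathbb{R}^n:x\ge0\}$, and $I$ is the $n\times n$ identity matrix. Given inputs $X_{0-}^1,\dots,X_{0-}^n$ and $Z^1,\dots,Z^n$, a (strong) solution on $[0,\tau)$ (respectively $[0,\tau]$) is a pair of processes $X=(X^1,\dots,X^n)$ and $L=(L^1,\dots,L^n)$ which simultaneously satisfy both families of equations in the system at time $0-$ and at all times in that (possibly random) interval. An extension of $(X,L)$ from $[0,\tau)$ to $[0,\tau]$ is a solution on $[0,\tau]$ that agrees with $(X,L)$ before time $\tau$. Relations between processes at random times are understood pathwise, almost surely. *)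

(* Defs.v *)
From HB Require Import structures.
From mathcomp Require Import all_boot all_order all_algebra.
From mathcomp Require Import all_classical all_reals all_analysis.
Set Implicit Arguments.
Unset Strict Implicit.
Unset Printing Implicit Defensive.
Import Order.TTheory GRing.Theory Num.Theory.
Import numFieldNormedType.Exports.
Local Open Scope classical_set_scope.
Local Open Scope ring_scope.

(* The index set {0-} U [0,oo): [None] is the point 0-.  Since [insub s] is
   [None] for s < 0, a real s denotes the time s if s >= 0 and 0- if s < 0. *)
Definition time (R : realType) : Type := option {x : R | 0 <= x}.

Definition at_time (R : realType) (s : R) : time R := insub s.

Definition clock (R : realType) (t : time R) : R :=
  if t is Some s then \val s else 0.

Definition time_le (R : realType) (s t : time R) : bool :=
  match s, t with
  | None, _ => true
  | Some _, None => false
  | Some a, Some b => \val a <= \val b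
  end.

Definition time_lt (R : realType) (s t : time R) : bool := ~~ time_le t s.

Definition before (R : realType) (T : R) : set (time R) :=
  [set t | time_lt t (at_time T)].

Definition upto (R : realType) (T : R) : set (time R) :=
  [set t | time_le t (at_time T)].

(* By the convention on [at_time], the left limit at 0 is the value at 0-. *)
Definition has_left_limit (R : realType) (f : time R -> R) (t : R) : Prop :=
  cvg (f (at_time s) @[s --> t^'-]).

Definition left_limit (R : realType) (f : time R -> R) (t : R) : R :=
  lim (f (at_time s) @[s --> t^'-]).

Definition jump (R : realType) (f : time R -> R) (t : R) : R :=
  f (at_time t) - left_limit f t.

(* Right continuity is relative to D, hence void at the right end of [0,T]. *)
Definition cadlag_on (R : realType) (D : set (time R)) (f : time R -> R) :
    Prop :=
  forall t : R, 0 <= t -> D (at_time t) ->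
    has_left_limit f t /\
    f (at_time s) @[s --> within (fun s => D (at_time s)) t^'+]
      --> f (at_time t).

Definition constant_between_jumps (R : realType) (f : time R -> R) : Prop :=
  forall s t : time R, time_le s t ->
    (forall u : R, 0 <= u -> time_lt s (at_time u) ->
       time_le (at_time u) t -> jump f u = 0) ->
    f s = f t.

Definition finitely_many_jumps (R : realType) (f : time R -> R) : Prop :=
  forall T : R, finite_set [set t : R | 0 <= t <= T /\ jump f t <> 0].

Definition filtration (R : realType) (d : measure_display)
    (Omega : measurableType d) (F : time R -> set (set Omega)) : Prop :=
  [/\ forall t, sigma_algebra setT (F t),
      forall t, F t `<=` measurable
    & forall s t, time_le s t -> F s `<=` F t].

(* Right continuity is required on [0,oo) only: F_{0-} may differ from F_0. *)
Definition usual_hypotheses (R : realType) (d : measure_display)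
    (Omega : measurableType d) (P : probability Omega R)
    (F : time R -> set (set Omega)) : Prop :=
  (forall N : set Omega, P.-negligible N -> F None N) /\
  (forall t : R, 0 <= t ->
     F (at_time t) = \bigcap_(s in [set s | t < s]) F (at_time s)).

Definition rv_wrt (R : realType) (Omega : Type) (G : set (set Omega))
    (f : Omega -> R) : Prop :=
  forall B : set R, measurable B -> G (f @^-1` B).

Definition adapted (R : realType) (Omega : Type)
    (F : time R -> set (set Omega)) (X : time R -> Omega -> R) : Prop :=
  forall t, rv_wrt (F t) (X t).

(* The random time tau need not be a stopping time of F.  A process living on
   [0,tau) or [0,tau] reveals tau once it has occurred, so adaptedness of such
   a process refers to F progressively enlarged by tau.  If tau is a stopping
   time of F this is F; on {t < tau} the enlarged sigma-algebra always has the
   same trace as F t. *)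
Definition enlarge (R : realType) (Omega : Type)
    (F : time R -> set (set Omega)) (tau : Omega -> R) (t : time R) :
    set (set Omega) :=
  <<s F t `|` [set [set w | tau w <= u] | u in
                 [set u : R | 0 <= u /\ time_le (at_time u) t]] >>.

Definition adapted_before (R : realType) (Omega : Type)
    (F : time R -> set (set Omega)) (tau : Omega -> R)
    (X : time R -> Omega -> R) : Prop :=
  forall t (B : set R), measurable B ->
    enlarge F tau t [set w | before (tau w) t /\ B (X t w)].

Definition stop (R : realType) (Omega : Type) (tau : Omega -> R)
    (X : time R -> Omega -> R) (t : time R) (w : Omega) : R :=
  X (if time_le t (at_time (tau w)) then t else at_time (tau w)) w.

Definition adapted_upto (R : realType) (Omega : Type)
    (F : time R -> set (set Omega)) (tau : Omega -> R)
    (X : time R -> Omega -> R) : Prop :=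
  adapted_before F tau X /\ adapted (enlarge F tau) (stop tau X).

Definition neg_part (R : realType) (a : R) : R := - Num.min 0 a.

Definition rnpath (R : realType) (n : nat) : Type := 'I_n -> time R -> R.

Definition path_of (R : realType) (n : nat) (Omega : Type)
    (X : 'I_n -> time R -> Omega -> R) (w : Omega) : rnpath R n :=
  fun i t => X i t w.

(* The supremum is taken in \bar R because [sup] of an unbounded set of reals
   is 0 by convention. *)
Definition path_solution (R : realType) (n : nat) (c : 'I_n -> R)
    (Q : 'M[R]_n) (x0 : 'I_n -> R) (z : rnpath R n) (D : set (time R))
    (x l : rnpath R n) : Prop :=
  [/\ forall i, cadlag_on D (x i) /\ cadlag_on D (l i),
      forall i, x i None = x0 i,
      forall i t, D t ->
        x i t = x0 i + c i * clock t - z i t + l i t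
                - \sum_(j | j != i) Q i j * l j t
    & forall i t, D t ->
        (l i t)%:E =
        ereal_sup [set (neg_part (x0 i + c i * clock s - z i s
                          - \sum_(j | j != i) Q i j * l j s))%:E
                  | s in [set s | time_le s t]]].

Definition solution_before (R : realType) (d : measure_display)
    (Omega : measurableType d) (P : probability Omega R)
    (F : time R -> set (set Omega)) (n : nat) (c : 'I_n -> R) (Q : 'M[R]_n)
    (X0 : 'I_n -> Omega -> R) (Z : 'I_n -> time R -> Omega -> R)
    (tau : Omega -> R) (X L : 'I_n -> time R -> Omega -> R) : Prop :=
  (forall i, adapted_before F tau (X i) /\ adapted_before F tau (L i)) /\
  \forall w \ae P, path_solution c Q (X0 ^~ w) (path_of Z w)
                     (before (tau w)) (path_of X w) (path_of L w).

Definition solution_upto (R : realType) (d : measure_display)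
    (Omega : measurableType d) (P : probability Omega R)
    (F : time R -> set (set Omega)) (n : nat) (c : 'I_n -> R) (Q : 'M[R]_n)
    (X0 : 'I_n -> Omega -> R) (Z : 'I_n -> time R -> Omega -> R)
    (tau : Omega -> R) (X L : 'I_n -> time R -> Omega -> R) : Prop :=
  (forall i, adapted_upto F tau (X i) /\ adapted_upto F tau (L i)) /\
  \forall w \ae P, path_solution c Q (X0 ^~ w) (path_of Z w)
                     (upto (tau w)) (path_of X w) (path_of L w).

Definition agree_before (R : realType) (n : nat) (T : R)
    (x l x' l' : rnpath R n) : Prop :=
  forall i t, before T t -> x' i t = x i t /\ l' i t = l i t.

Definition extension (R : realType) (d : measure_display)
    (Omega : measurableType d) (P : probability Omega R)
    (F : time R -> set (set Omega)) (n : nat) (c : 'I_n -> R) (Q : 'M[R]_n)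
    (X0 : 'I_n -> Omega -> R) (Z : 'I_n -> time R -> Omega -> R)
    (tau : Omega -> R) (X L X' L' : 'I_n -> time R -> Omega -> R) : Prop :=
  solution_upto P F c Q X0 Z tau X' L' /\
  \forall w \ae P, agree_before (tau w) (path_of X w) (path_of L w)
                     (path_of X' w) (path_of L' w).

(* The increments of l at T that extend the path (x, l) from [0,T) to [0,T]. *)
Definition admissible_jump (R : realType) (n : nat) (c : 'I_n -> R)
    (Q : 'M[R]_n) (x0 : 'I_n -> R) (z : rnpath R n) (T : R) (x l : rnpath R n) :
    set 'cV[R]_n :=
  [set y : 'cV[R]_n | (forall i, 0 <= y i 0) /\
     exists x' l' : rnpath R n,
       [/\ path_solution c Q x0 z (upto T) x' l',
           agree_before T x l x' l'
         & forall i, l' i (at_time T) = left_limit (l i) T + y i 0]].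

Definition minimal_in (R : realType) (n : nat) (S : set 'cV[R]_n)
    (y : 'cV[R]_n) : Prop :=
  S y /\ forall y', S y' -> (forall i, y' i 0 <= y i 0) -> y' = y.

Definition unique_minimal_in (R : realType) (n : nat) (S : set 'cV[R]_n)
    (y : 'cV[R]_n) : Prop :=
  minimal_in S y /\ forall y', minimal_in S y' -> y' = y.

Definition coneC (R : realType) (n : nat) (Q : 'M[R]_n) : set 'cV[R]_n :=
  [set u : 'cV[R]_n | (forall i, 0 <= u i 0) /\
           forall j, (u^T *m (1%:M - Q)) 0 j <= 0].

Definition dual_cone (R : realType) (n : nat) (C : set 'cV[R]_n) :
    set 'cV[R]_n :=
  [set y : 'cV[R]_n | forall u, C u -> 0 <= (u^T *m y) 0 0].

(* X_{tau-} - Delta Z_tau *)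
Definition pre_reflection (R : realType) (n : nat) (Omega : Type)
    (X Z : 'I_n -> time R -> Omega -> R) (tau : Omega -> R) (w : Omega) :
    'cV[R]_n :=
  \col_i (left_limit (path_of X w i) (tau w) - jump (path_of Z w i) (tau w)).

(* Main.v *)
Require Import Defs.
From HB Require Import structures.
From mathcomp Require Import all_boot all_order all_algebra.
From mathcomp Require Import all_classical all_reals all_analysis.
From mathcomp Require Import measurable_realfun ring lra.
Import Order.TTheory GRing.Theory Num.Theory.
Import numFieldNormedType.Exports.
Local Open Scope classical_set_scope.
Local Open Scope ring_scope.
Set Implicit Arguments.
Unset Strict Implicit.

(** Everything happens at the instant tau, one path at a time.  Let p be
    X_{tau-} - Delta Z_tau and let y be a candidate for Delta L_tau.  Comparing
    the equations at tau with their left limits, and using that L is the running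
    supremum of the deficits, the system at tau reduces to the fixed-point
    equation y_i = max(0, (Q y - p)_i), that is y = [reflect_step Q p y]:
    [fixpoint_extends] turns a solution of it into an extension of the path, and
    [extension_jump_supersolution] shows that the jump of any extension at least
    satisfies [reflect_step Q p y <= y].

    As Q is non-negative, [reflect_step] is monotone.  Its iterates from 0 are
    therefore nondecreasing and lie below every supersolution; if there is one,
    they converge to a vector [least_jump Q p] which is a fixed point
    ([least_jump_fix]) and lies below every supersolution ([least_jump_le]).
    Being the least admissible jump, it is the unique minimal one.

    A supersolution is a y >= 0 with (I - Q) y + p >= 0.  By Farkas' lemma such a
    y exists unless some u >= 0 has u^T (I - Q) <= 0 and u^T p < 0, in other words
    if and only if p lies in the dual cone of C ([dual_coneP]).

    It remains to see that the extended processes are adapted to the filtration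
    enlarged by tau.  On {tau <= s} the left limits at tau are limits of samples
    taken on a grid strictly before tau ([measurable_left_limit]), and Z_tau is a
    limit of samples taken after tau but no later than s
    ([measurable_value_at]).  The minimal jump, a limit of explicit iterates, is
    then measurable as well ([least_jump_measurable]).  All this holds off a null
    set, and null sets belong to every sigma-algebra of the filtration
    ([continue_at_adapted]). *)

(** * Farkas' lemma and the dual cone *)

Lemma sum_delta (R : pzRingType) (I : finType) (f : I -> R) (i : I) :
  \sum_l (l == i)%:R * f l = f i.
Proof.
rewrite (bigD1 i) //= eqxx mul1r big1 ?addr0 // => l /negPf ->.
by rewrite mul0r.
Qed.

Lemma between_families (R : realFieldType) (I : finType) (lower upper : pred I)
    (lo up : I -> R) :
    (forall k i, lower k -> upper i -> lo k <= up i) ->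
  exists t, (forall k, lower k -> lo k <= t) /\ (forall i, upper i -> t <= up i).
Proof.
move=> lo_up; have [k0 lk0|no_lower] := pickP lower.
  case: (arg_maxP lo lk0) => k lk kmax.
  by exists (lo k); split=> [//|i ui]; exact: lo_up.
have [i0 ui0|no_upper] := pickP upper.
  case: (arg_minP up ui0) => i ui imin.
  by exists (up i); split=> [k|//]; rewrite no_lower.
by exists 0; split=> i; rewrite ?no_lower ?no_upper.
Qed.

(** Fourier-Motzkin elimination of the first variable: the inequalities with a
    positive coefficient bound it above, those with a negative coefficient bound
    it below, and the remaining variables must make each lower bound at most each
    upper bound.  These conditions are non-negative combinations of the original
    inequalities, so certificates of infeasibility pull back along them. *)
Lemma farkas (R : realFieldType) (n : nat) (I : finType)
    (a : I -> 'I_n -> R) (b : I -> R) :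
    (forall u : I -> R, (forall i, 0 <= u i) ->
       (forall j, \sum_i u i * a i j = 0) -> 0 <= \sum_i u i * b i) ->
  exists y : 'I_n -> R, forall i, \sum_j a i j * y j <= b i.
Proof.
elim: n I a b => [|n IHn] I a b feas.
  exists (fun=> 0) => i; rewrite big_ord0.
  have := feas (fun l => (l == i)%:R) (fun l => ler0n _ _).
  by rewrite sum_delta; apply; case.
(* M is the non-negative matrix of the eliminated system: the row (i, k) combines
   a positive inequality i with a negative inequality k so as to cancel the first
   variable, the row (i, i) keeps an inequality i free of that variable, and
   every other row is zero. *)
pose M (r : I * I) l : R :=
  if (0 < a r.1 ord0) && (a r.2 ord0 < 0)
  then (a r.1 ord0)^-1 * (l == r.1)%:R + (- a r.2 ord0)^-1 * (l == r.2)%:R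
  else ((a r.1 ord0 == 0) && (r.1 == r.2))%:R * (l == r.1)%:R.
have sumM (f : I -> R) r : \sum_l M r l * f l =
    if (0 < a r.1 ord0) && (a r.2 ord0 < 0)
    then (a r.1 ord0)^-1 * f r.1 + (- a r.2 ord0)^-1 * f r.2
    else ((a r.1 ord0 == 0) && (r.1 == r.2))%:R * f r.1.
  rewrite /M; case: ifP => _.
    under eq_bigr do rewrite mulrDl -!mulrA.
    by rewrite big_split /= -!mulr_sumr !sum_delta.
  under eq_bigr do rewrite -mulrA.
  by rewrite -mulr_sumr sum_delta.
have M_ge0 r l : 0 <= M r l.
  rewrite /M; case: ifP => [/andP[a1 a2]|_].
    by rewrite addr_ge0 // mulr_ge0 // invr_ge0 ltW // oppr_gt0.
  by rewrite mulr_ge0.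
have M0 r : \sum_l M r l * a l ord0 = 0.
  rewrite sumM; case: ifP => [/andP[a1 a2]|_].
    by rewrite mulVf ?gt_eqF // invrN mulNr mulVf ?subrr ?lt_eqF.
  by case: eqP => [->|]; rewrite ?mulr0 ?mul0r.
have exch (u : I * I -> R) (f : I -> R) :
    \sum_l (\sum_r u r * M r l) * f l = \sum_r u r * \sum_l M r l * f l.
  under eq_bigr do rewrite mulr_suml.
  rewrite exchange_big; apply: eq_bigr => r _.
  by rewrite mulr_sumr; apply: eq_bigr => l _; rewrite mulrA.
have [u u_ge0 u0|y yP] := IHn _ (fun r j => \sum_l M r l * a l (lift ord0 j))
    (fun r => \sum_l M r l * b l).
  rewrite -exch; apply: feas => [l|j].
    by apply: sumr_ge0 => r _; rewrite mulr_ge0.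
  rewrite exch; have [j' ->|->] := unliftP ord0 j; first exact: u0.
  by rewrite big1 // => r _; rewrite M0 mulr0.
(* e i is the room that inequality i leaves for the eliminated variable. *)
pose e i := b i - \sum_j a i (lift ord0 j) * y j.
have eP r : 0 <= \sum_l M r l * e l.
  have := yP r; rewrite -subr_ge0; congr (_ <= _).
  under [RHS]eq_bigr do rewrite mulrBr mulr_sumr.
  rewrite big_split /= sumrN exchange_big; congr (_ - _).
  apply: eq_bigr => j _; rewrite mulr_suml.
  by apply: eq_bigr => l _; rewrite mulrA.
have [|t [t_ge t_le]] := @between_families R I [pred k | a k ord0 < 0]
    [pred i | 0 < a i ord0] (fun k => e k / a k ord0) (fun i => e i / a i ord0).
  move=> k i /= ak ai; have := eP (i, k).
  rewrite sumM /= ai ak /= invrN mulNr subr_ge0.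
  by rewrite ![_^-1 * _]mulrC.
exists (fun j => if unlift ord0 j is Some j' then y j' else t) => i.
rewrite big_ord_recl unlift_none.
under eq_bigr do rewrite liftK.
rewrite -lerBrDr -/(e i).
have [ai|ai|ai] := ltrgt0P (a i ord0).
- by rewrite mulrC -ler_pdivlMr //; exact: t_le.
- by rewrite mulrC -ler_ndivrMr //; exact: t_ge.
- have := eP (i, i); rewrite sumM /= ai ltxx /= !eqxx mul1r.
  by rewrite mul0r.
Qed.

(** The jump imposed on component i when the others jump by y: the amount by which
    p - Q y falls below 0. *)
Definition reflect_step (R : realType) (n : nat) (Q : 'M[R]_n) (p : 'cV[R]_n)
    (y : 'I_n -> R) (i : 'I_n) : R :=
  Num.max 0 (\sum_j Q i j * y j - p i 0).

(** Being a supersolution y means y >= 0 and (I - Q) y + p >= 0.  For u in C this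
    gives u^T p >= - u^T (I - Q) y >= 0; the converse is [farkas], in which the
    multipliers of the inequalities y >= 0 are the slack in u^T (I - Q) <= 0. *)
Lemma dual_coneP (R : realType) (n : nat) (Q : 'M[R]_n) (p : 'cV[R]_n) :
  dual_cone (coneC Q) p <->
  exists y : 'I_n -> R, forall i, reflect_step Q p y i <= y i.
Proof.
have mulE (u : 'cV[R]_n) j :
    (u^T *m (1%:M - Q)) 0 j = u j 0 - \sum_i u i 0 * Q i j.
  rewrite mulmxBr mulmx1 !mxE; congr (_ - _).
  by apply: eq_bigr => i _; rewrite mxE.
have dotE (u : 'cV[R]_n) : (u^T *m p) 0 0 = \sum_i u i 0 * p i 0.
  by rewrite mxE; apply: eq_bigr => i _; rewrite mxE.
split=> [pC|[y yP] u [u_ge0 uC]]; last first.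
  have y_ge0 i : 0 <= y i by have := yP i; rewrite ge_max => /andP[].
  rewrite dotE.
  apply: (@le_trans _ _ (\sum_i u i 0 * (\sum_j Q i j * y j - y i))).
    under eq_bigr do rewrite mulrBr mulr_sumr.
    rewrite big_split /= sumrN exchange_big /= -sumrN -big_split; apply: sumr_ge0 => j _.
    under eq_bigr do rewrite mulrA.
    rewrite /= -mulr_suml -mulrBl mulr_ge0 //.
    by have := uC j; rewrite mulE subr_le0 subr_ge0.
  apply: ler_sum => i _; apply: ler_wpM2l => //.
  have := yP i; rewrite ge_max => /andP[_].
  by rewrite lerBlDr => ?; rewrite lerBlDl.
have [u u_ge0 u0|y yP] := @farkas R n ('I_n + 'I_n)%type
    (fun r j => match r with inl i => Q i j - (i == j)%:R
                           | inr i => - (i == j)%:R end)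
    (fun r => match r with inl i => p i 0 | inr i => 0 end).
  rewrite big_sumType /= [X in _ + X]big1 ?addr0 => [|i _]; last first.
    by rewrite mulr0.
  suff /pC : coneC Q (\col_i u (inl i)).
    by rewrite dotE => /le_trans; apply; apply: ler_sum => i _; rewrite mxE.
  split=> [i|j]; first by rewrite mxE.
  rewrite mulE mxE; under eq_bigr do rewrite mxE.
  have : \sum_i u (inl i) * Q i j - u (inl j) - u (inr j) = 0.
    apply: etrans (u0 j); rewrite big_sumType /= -[u (inl j)](sum_delta (fun i => u (inl i))).
    rewrite -[u (inr j)](sum_delta (fun i => u (inr i))).
    rewrite -sumrB -sumrN; congr (_ + _); apply: eq_bigr => i _.
      by rewrite mulrBr [_%:R * _]mulrC.
    by rewrite mulrN mulrC.
  by move/eqP; rewrite subr_eq0 => /eqP diff; rewrite -opprB diff oppr_le0.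
exists y => i; rewrite ge_max; apply/andP; split.
  have := yP (inr i); under eq_bigr do rewrite mulNr eq_sym.
  by rewrite sumrN sum_delta oppr_le0.
have := yP (inl i); under eq_bigr do rewrite mulrBl eq_sym.
by rewrite sumrB sum_delta lerBlDr lerBlDl addrC.
Qed.

(** * The least fixed point of the reflection map *)

Definition approx_jump (R : realType) (n : nat) (Q : 'M[R]_n) (p : 'cV[R]_n)
    (k : nat) : 'I_n -> R :=
  iter k (reflect_step Q p) (fun=> 0).

(** Taken as a limit of iterates rather than as an infimum of supersolutions, so
    that its measurability in p follows from that of [reflect_step]. *)
Definition least_jump (R : realType) (n : nat) (Q : 'M[R]_n) (p : 'cV[R]_n) :
    'cV[R]_n :=
  \col_i limn (approx_jump Q p ^~ i).

Lemma le_reflect_step (R : realType) (n : nat) (Q : 'M[R]_n) (p : 'cV[R]_n)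
    (Q_ge0 : forall i j, 0 <= Q i j) (y z : 'I_n -> R) :
    (forall i, y i <= z i) ->
  forall i, reflect_step Q p y i <= reflect_step Q p z i.
Proof.
move=> yz i; rewrite le_max2 // lerB // ler_sum // => j _.
exact: ler_wpM2l.
Qed.

Section least_jump.
Context (R : realType) (n : nat) (Q : 'M[R]_n) (p : 'cV[R]_n).
Context (Q_ge0 : forall i j, 0 <= Q i j).

Lemma approx_jump_le (y : 'I_n -> R) :
    (forall i, reflect_step Q p y i <= y i) ->
  forall k i, approx_jump Q p k i <= y i.
Proof.
move=> yP; elim=> [|k IHk] i.
  by have := yP i; rewrite ge_max => /andP[].
by apply: le_trans (yP i); exact: le_reflect_step.
Qed.

Lemma approx_jump_nondecreasing i :
  {homo (approx_jump Q p ^~ i) : k m / (k <= m)%N >-> k <= m}.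
Proof.
apply/nondecreasing_seqP => k; elim: k i => [|k IHk] i.
  by rewrite /approx_jump /= le_max lexx.
exact: le_reflect_step.
Qed.

(** A supersolution bounds the nondecreasing iterates, hence they converge. *)
Lemma approx_jump_cvg (y : 'I_n -> R) :
    (forall i, reflect_step Q p y i <= y i) ->
  forall i, approx_jump Q p k i @[k --> \oo] --> least_jump Q p i 0.
Proof.
move=> yP i; rewrite mxE; apply: nondecreasing_is_cvgn.
  exact: approx_jump_nondecreasing.
by exists (y i) => _ [k _ <-]; exact: approx_jump_le.
Qed.

Lemma approx_jump_le_lim (y : 'I_n -> R) :
    (forall i, reflect_step Q p y i <= y i) ->
  forall k i, approx_jump Q p k i <= least_jump Q p i 0.
Proof.
move=> yP k i; have /cvgP cv := @approx_jump_cvg y yP i; rewrite mxE.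
exact: (nondecreasing_cvgn_le (@approx_jump_nondecreasing i)).
Qed.

Lemma least_jump_le (y : 'I_n -> R) :
    (forall i, reflect_step Q p y i <= y i) ->
  forall i, least_jump Q p i 0 <= y i.
Proof.
move=> yP i; have /cvgP cv := @approx_jump_cvg y yP i.
by rewrite mxE; apply: limr_le => //; near=> k; exact: approx_jump_le.
Unshelve. all: by end_near. Qed.

(** Both inequalities come from passing to the limit in
    [approx_jump k.+1 = reflect_step (approx_jump k)]: the iterates stay below the
    image of their limit by monotonicity, and the affine part of [reflect_step] is
    continuous. *)
Lemma least_jump_fix (y : 'I_n -> R) :
    (forall i, reflect_step Q p y i <= y i) ->
  forall i, least_jump Q p i 0 = reflect_step Q p (fun j => least_jump Q p j 0) i.
Proof.
move=> yP i; apply/eqP; rewrite eq_le; apply/andP; split.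
  have /cvgP cv := @approx_jump_cvg y yP i.
  rewrite {1}/least_jump mxE; apply: limr_le => //; near=> k.
  apply: le_trans (@approx_jump_nondecreasing i _ _ (leqnSn k)) _.
  by apply: le_reflect_step => // j; exact: approx_jump_le_lim.
rewrite ge_max; apply/andP; split; first exact: (approx_jump_le_lim yP 0).
have step_cvg : \sum_j Q i j * approx_jump Q p k j - p i 0 @[k --> \oo] -->
    \sum_j Q i j * least_jump Q p j 0 - p i 0.
  apply: cvgB; last exact: cvg_cst.
  apply: cvg_big => [|j _]; first exact: add_continuous.
  apply: cvgM; first exact: cvg_cst.
  exact: (@approx_jump_cvg y yP j).
rewrite -(cvg_lim _ step_cvg) //; apply: limr_le; first exact/cvgP/step_cvg.
near=> k; apply: le_trans (approx_jump_le_lim yP k.+1 i).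
by rewrite /approx_jump /= le_max lexx orbT.
Unshelve. all: by end_near. Qed.
End least_jump.

(** * Times and left limits *)

Lemma time_le_refl (R : realType) (t : time R) : time_le t t.
Proof. by case: t => [s|] /=. Qed.

Lemma time_le_trans (R : realType) (s t u : time R) :
  time_le s t -> time_le t u -> time_le s u.
Proof. by case: s t u => [s|] [t|] [u|] //=; exact: le_trans. Qed.

Lemma time_le_anti (R : realType) (s t : time R) :
  time_le s t -> time_le t s -> s = t.
Proof.
case: s t => [s|] [t|] //= st ts.
by congr Some; apply/val_inj/le_anti; rewrite st.
Qed.

Lemma time_ltW (R : realType) (s t : time R) : time_lt s t -> time_le s t.
Proof.
by case: s t => [s|] [t|] //=; rewrite /time_lt /= -ltNge; exact: ltW.
Qed.

Lemma time_le_at (R : realType) (s t : R) :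
  0 <= s -> time_le (at_time s) (at_time t) = (s <= t).
Proof.
rewrite /at_time => s0; case: insubP => [u _ us|]; last by rewrite s0.
case: insubP => [v _ vt /=|t0 /=]; first by rewrite us vt.
by apply/esym/negbTE; move: t0; rewrite -!ltNge => /lt_le_trans; apply.
Qed.

(** Negative reals stand for 0-, where the clock reads 0; this also makes the clock
    left-continuous at 0. *)
Lemma clock_at (R : realType) (s : R) : clock (at_time s) = Num.max 0 s.
Proof.
rewrite /at_time; case: insubP => [u s0 us|] /=; first by rewrite us; case: leP s0.
by rewrite -ltNge => s0; case: leP => // /le_lt_trans /(_ s0); rewrite ltxx.
Qed.

Lemma before_at (R : realType) (T s : R) :
  0 <= T -> before T (at_time s) <-> s < T.
Proof.
by move=> T0; rewrite /before /= /time_lt time_le_at // -ltNge.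
Qed.

Lemma before_None (R : realType) (T : R) : 0 <= T -> before T None.
Proof.
by rewrite /before /= /time_lt /at_time => T0; case: insubP => //; rewrite T0.
Qed.

Lemma uptoP (R : realType) (T : R) (t : time R) :
  upto T t <-> before T t \/ t = at_time T.
Proof.
split=> [tT|[/time_ltW//|->]]; last exact: time_le_refl.
have [Tt|Tt] := boolP (time_le (at_time T) t).
  by right; exact: time_le_anti.
by left.
Qed.

Lemma before_trans (R : realType) (T : R) (s t : time R) :
  before T t -> time_le s t -> before T s.
Proof.
by rewrite /before /= => tT st; apply: contra tT => /time_le_trans; apply.
Qed.

Lemma agree_left_cvg (R : realType) (T : R) (f g : time R -> R) (l : R) :
    0 <= T -> (forall t, before T t -> g t = f t) ->
  f (at_time s) @[s --> T^'-] --> l -> g (at_time s) @[s --> T^'-] --> l.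
Proof.
move=> T0 gf; apply: cvg_trans; apply: near_eq_cvg; near=> s.
by apply/esym/gf/before_at.
Unshelve. all: by end_near. Qed.

Lemma clock_left_cvg (R : realType) (T : R) :
  0 <= T -> clock (at_time s) @[s --> T^'-] --> T.
Proof.
move=> T0; under eq_cvg do rewrite clock_at.
have max_cvg : Num.max 0 s @[s --> T^'-] --> Num.max 0 T.
  apply: cvg_at_left_filter.
  exact: (@continuous_max R R (fun=> 0) id T (@cst_continuous _ _ _ _) (@cvg_id _ _)).
by rewrite max_r in max_cvg.
Qed.

Lemma neg_partE (R : realType) (a : R) : neg_part a = Num.max 0 (- a).
Proof. by rewrite /neg_part oppr_min oppr0. Qed.

(** * Jump of a path at the terminal time *)

Lemma sum_offdiag (R : realType) (n : nat) (Q : 'M[R]_n) (f : 'I_n -> R) i :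
  Q i i = 0 -> \sum_(j | j != i) Q i j * f j = \sum_j Q i j * f j.
Proof. by move=> Qii; rewrite [RHS](bigD1 i) //= Qii mul0r add0r. Qed.

Section paths.
Context (R : realType) (n : nat) (c : 'I_n -> R) (Q : 'M[R]_n) (x0 : 'I_n -> R).
Context (z : rnpath R n).

Lemma neg_part_le_regulator (D : set (time R)) (x l : rnpath R n) i s t :
    path_solution c Q x0 z D x l -> D t -> time_le s t ->
  neg_part (x0 i + c i * clock s - z i s - \sum_(j | j != i) Q i j * l j s)
    <= l i t.
Proof.
move=> [_ _ _ lE] Dt st; rewrite -lee_fin lE //.
by apply: ereal_sup_ubound; exists s.
Qed.

Lemma regulator_mono (D : set (time R)) (x l : rnpath R n) i s t :
    path_solution c Q x0 z D x l -> D s -> D t -> time_le s t ->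
  l i s <= l i t.
Proof.
move=> sol Ds Dt st; rewrite -lee_fin; have [_ _ _ ->//] := sol.
apply: ub_ereal_sup => _ [u us <-].
rewrite lee_fin.
exact: neg_part_le_regulator sol Dt (time_le_trans us st).
Qed.

Lemma regulator_ge0 (D : set (time R)) (x l : rnpath R n) i t :
  path_solution c Q x0 z D x l -> D t -> 0 <= l i t.
Proof.
move=> sol Dt; have := neg_part_le_regulator i sol Dt (time_le_refl t).
by apply: le_trans; rewrite neg_partE le_max lexx.
Qed.

Section at_terminal_time.
Context (T : R) (x l : rnpath R n).
Context (T_ge0 : 0 <= T).
Context (Q_diag : forall i, Q i i = 0).
Context (sol : path_solution c Q x0 z (before T) x l).
Context (x_lim : forall i, has_left_limit (x i) T).
Context (l_lim : forall i, has_left_limit (l i) T).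
Context (z_lim : forall i, has_left_limit (z i) T).

Let p : 'cV[R]_n := \col_i (left_limit (x i) T - jump (z i) T).

Lemma regulator_le_left_limit i t : before T t -> l i t <= left_limit (l i) T.
Proof.
move=> tT; apply: limr_ge; first exact: l_lim.
case: t tT => [t|]; last first.
  move=> _; near=> s; apply: (regulator_mono i sol) => //.
    exact: before_None.
  by apply/before_at.
move=> tT; have ttE : Some t = at_time (\val t).
  by rewrite /at_time valK.
have tltT : \val t < T by apply/before_at => //; rewrite -ttE.
near=> s; apply: (regulator_mono i sol) => //; first by apply/before_at.
rewrite ttE time_le_at; last exact: (valP t).
near: s; exact: nbhs_left_ge.
Unshelve. all: by end_near. Qed.

Lemma left_limit_regulator_le i (M : R) :
  (forall t, before T t -> l i t <= M) -> left_limit (l i) T <= M.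
Proof.
move=> lM; apply: limr_le; first exact: l_lim.
by near=> s; apply: lM; apply/before_at.
Unshelve. all: by end_near. Qed.

Lemma left_limit_regulator_ge0 i : 0 <= left_limit (l i) T.
Proof.
have N := before_None T_ge0.
exact: le_trans (regulator_ge0 i sol N) (regulator_le_left_limit i N).
Qed.

(** The equation for x passes to left limits, the drift being left-continuous. *)
Lemma left_limit_state i :
  left_limit (x i) T = x0 i + c i * T - left_limit (z i) T + left_limit (l i) T
                       - \sum_j Q i j * left_limit (l j) T.
Proof.
apply: cvg_lim => //; apply: (@agree_left_cvg R T (fun t =>
  x0 i + c i * clock t - z i t + l i t - \sum_j Q i j * l j t)) => //.
  by move=> t tT; have [_ _ -> //] := sol; rewrite sum_offdiag.
apply: cvgB; last first.
  apply: cvg_big => [|j _]; first exact: add_continuous.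
  by apply: cvgM; [exact: cvg_cst | exact: l_lim].
apply: cvgD; last exact: l_lim.
apply: cvgB; last exact: z_lim.
apply: cvgD; first exact: cvg_cst.
by apply: cvgM; [exact: cvg_cst | exact: clock_left_cvg].
Qed.

(** The key computation: if l jumps by y, then the deficit at T, that is minus the
    unregulated state, is the left limit of l plus Q y - p.  So l, a running
    supremum of deficits, has to jump by max(0, Q y - p). *)
Lemma regulator_deficit (y : 'I_n -> R) i :
  - (x0 i + c i * clock (at_time T) - z i (at_time T)
     - \sum_(j | j != i) Q i j * (left_limit (l j) T + y j)) =
  left_limit (l i) T + (\sum_j Q i j * y j - p i 0).
Proof.
rewrite sum_offdiag // clock_at mxE left_limit_state /jump.
rewrite (max_r T_ge0).
under eq_bigr do rewrite mulrDr.
rewrite big_split /=; ring.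
Qed.

(** The regulator of an extension dominates its own past and the deficit at T; by
    [regulator_deficit] these are the two halves of the inequality. *)
Lemma extension_jump_supersolution (x' l' : rnpath R n) :
    path_solution c Q x0 z (upto T) x' l' -> agree_before T x l x' l' ->
  forall i, reflect_step Q p (fun j => l' j (at_time T) - left_limit (l j) T) i
            <= l' i (at_time T) - left_limit (l i) T.
Proof.
move=> sol' agree i.
have uT : upto T (at_time T) by exact: time_le_refl.
rewrite ge_max; apply/andP; split; rewrite ?subr_ge0.
  apply: left_limit_regulator_le => t tT; have [_ <-] := agree i _ tT.
  by apply: (regulator_mono i sol') => //; exact: time_ltW.
rewrite lerBrDl -regulator_deficit.
under eq_bigr do rewrite addrC subrK.
have := neg_part_le_regulator i sol' uT (time_le_refl _).
by apply: le_trans; rewrite neg_partE le_max lexx orbT.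
Qed.

(** For a fixed point y the supremum defining l' at T is attained: when Q y - p is
    positive in component i the deficit at T is the new value, and otherwise
    l' does not jump and keeps the supremum of the past. *)
Lemma fixpoint_extends (y : 'I_n -> R) (x' l' : rnpath R n) :
    (forall i, y i = reflect_step Q p y i) -> agree_before T x l x' l' ->
    (forall i, x' i (at_time T) = p i 0 + y i - \sum_j Q i j * y j) ->
    (forall i, l' i (at_time T) = left_limit (l i) T + y i) ->
  path_solution c Q x0 z (upto T) x' l'.
Proof.
move=> y_fix agree x'T l'T.
have y_ge0 i : 0 <= y i by rewrite y_fix le_max lexx.
have [cad x_init xE lE] := sol.
have agree_x i t (tT : before T t) : x' i t = x i t by have [] := agree i t tT.
have agree_l i t (tT : before T t) : l' i t = l i t by have [] := agree i t tT.
have extend_cadlag (f f' : time R -> R) : cadlag_on (before T) f ->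
    has_left_limit f T -> (forall t, before T t -> f' t = f t) ->
    cadlag_on (upto T) f'.
  move=> fcad flim f'f t t0 tT.
  have [t_before|/(congr1 (@clock R))] := (uptoP T (at_time t)).1 tT.
    have tltT : t < T by apply/before_at.
    have [flimt fright] := fcad t t0 t_before; split.
      apply/cvg_ex; exists (left_limit f t).
      apply: agree_left_cvg flimt => // s s_t; apply: f'f.
      exact: before_trans t_before (time_ltW s_t).
    rewrite f'f // => A /fright; rewrite /= !nbhs_simpl /= /within /=.
    have : \forall s \near t^'+, s < T by exact: nbhs_right_lt.
    apply: filterS2 => s sT + _; rewrite f'f; last exact/before_at.
    by apply; apply/before_at.
  rewrite !clock_at (max_r t0) (max_r T_ge0) => ->; split.
    apply/cvg_ex; exists (left_limit f T).
    exact: agree_left_cvg flim.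
  move=> A _; rewrite /= !nbhs_simpl /= /within /=.
  have : \forall s \near T^'+, T < s by exact: nbhs_right_gt.
  apply: filterS => s Ts; rewrite /upto /= time_le_at; last first.
    exact: ltW (le_lt_trans T_ge0 Ts).
  by rewrite leNgt Ts.
split.
- move=> i; have [xcad lcad] := cad i; split.
    exact: extend_cadlag xcad (@x_lim i) (agree_x i).
  exact: extend_cadlag lcad (@l_lim i) (agree_l i).
- by move=> i; rewrite agree_x //; exact: before_None.
- move=> i t /uptoP[tT|->].
    rewrite agree_x // agree_l // xE //; congr (_ - _).
    by apply: eq_bigr => j _; rewrite agree_l.
  have := regulator_deficit y i.
  under eq_bigr do rewrite -l'T.
  rewrite x'T l'T => /eqP; rewrite eqr_oppLR => /eqP.
  by move: (\sum_(j | _) _) => S; lra.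
- move=> i t /uptoP[tT|->].
    rewrite agree_l // lE //; congr ereal_sup; apply: eq_imagel => s st.
    congr (neg_part (_ - _))%:E; apply: eq_bigr => j _.
    by rewrite agree_l //; exact: before_trans st.
  set S := [set _ | _ in _].
  have S_before s : before T s -> ((l i s)%:E <= ereal_sup S)%E.
    move=> sT; rewrite lE //; apply: le_ereal_sup => _ [u us <-].
    exists u => /=; first exact: time_le_trans us (time_ltW sT).
    congr (neg_part (_ - _))%:E; apply: eq_bigr => j _.
    by rewrite agree_l //; exact: before_trans us.
  have deficitE : - (x0 i + c i * clock (at_time T) - z i (at_time T)
        - \sum_(j | j != i) Q i j * l' j (at_time T)) =
      left_limit (l i) T + (\sum_j Q i j * y j - p i 0).
    by rewrite -regulator_deficit; under eq_bigr do rewrite l'T.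
  apply/eqP; rewrite eq_le; apply/andP; split.
    (* Either component i jumps and the deficit at T is the value reached, or it
       does not and the bound comes from the past. *)
    rewrite l'T y_fix /reflect_step; case: (leP 0 (_ - _)) => _; last first.
      rewrite addr0.
      have := S_before None (before_None T_ge0).
      case: (ereal_sup S) S_before => [r||] // S_before _.
        rewrite lee_fin; apply: left_limit_regulator_le => s sT.
        by rewrite -lee_fin S_before.
      by rewrite leey.
    apply: (@le_trans _ _ (neg_part (x0 i + c i * clock (at_time T)
        - z i (at_time T) - \sum_(j | j != i) Q i j * l' j (at_time T)))%:E).
      by rewrite lee_fin neg_partE deficitE le_max lexx orbT.
    by apply: ereal_sup_ubound; exists (at_time T) => //; exact: time_le_refl.
  apply: ub_ereal_sup => _ [s /uptoP[sT|->] <-]; rewrite lee_fin l'T.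
    apply: (@le_trans _ _ (l i s)); last first.
      rewrite -[leLHS]addr0 lerD //; exact: regulator_le_left_limit.
    under eq_bigr do rewrite agree_l //.
    by apply: (neg_part_le_regulator i sol) => //; exact: time_le_refl.
  rewrite neg_partE deficitE ge_max addr_ge0 ?left_limit_regulator_ge0 //=.
  by rewrite lerD2l [leRHS]y_fix le_max lexx orbT.
Qed.

End at_terminal_time.
End paths.

(** * Sampling a process near a random time *)

(** The number of the cell ](m - 1) / (k + 1), m / (k + 1)] of the grid of mesh
    1 / (k + 1) that contains x.  The cells are open on the left so that
    (m - 1) / (k + 1) is strictly before x; for x = 0 it is negative, which as a
    time is 0-. *)
Definition grid_index (R : realType) (x : R) (k : nat) : nat :=
  `|Num.ceil (k.+1%:R * x)|%N.

Lemma grid_index_eq (R : realType) (x : R) (k m : nat) : 0 <= x ->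
  grid_index x k = m <-> (m%:R - 1) / k.+1%:R < x <= m%:R / k.+1%:R.
Proof.
move=> x0; rewrite ltr_pdivrMr ?ltr0n // ler_pdivlMr ?ltr0n // mulrC.
have ceil_ge0 : 0 <= Num.ceil (k.+1%:R * x).
  by rewrite ceil_ge0; apply: lt_le_trans (mulr_ge0 _ x0) => //; rewrite ltrN10.
rewrite /grid_index; split=> [<-|xm].
  have := ceil_itv (k.+1%:R * x); rewrite rmorphB /=.
  by rewrite natr_absz ger0_norm.
by rewrite (@ceil_def _ _ m%:Z) ?absz_nat // rmorphB.
Qed.

Lemma grid_indexP (R : realType) (x : R) (k : nat) : 0 <= x ->
  ((grid_index x k)%:R - 1) / k.+1%:R < x <= (grid_index x k)%:R / k.+1%:R.
Proof. by move=> x0; exact/grid_index_eq. Qed.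

Lemma grid_cvg (R : realType) (x a : R) : 0 <= x ->
  ((grid_index x k)%:R + a) / k.+1%:R @[k --> \oo] --> x.
Proof.
move=> x0; apply: (@squeeze_cvgr _ _ _ _
    (fun k => x + a * k.+1%:R^-1) (fun k => x + (1 + a) * k.+1%:R^-1)).
- near=> k; have /andP[lo up] := grid_indexP k x0.
  by move: k.+1%:R^-1 lo up => e lo up; apply/andP; split; lra.
- rewrite -[X in _ --> X]addr0; apply: cvgD; first exact: cvg_cst.
  rewrite -(mulr0 a); apply: cvgM; first exact: cvg_cst.
  exact: cvg_harmonic.
- rewrite -[X in _ --> X]addr0; apply: cvgD; first exact: cvg_cst.
  rewrite -(mulr0 (1 + a)); apply: cvgM; first exact: cvg_cst.
  exact: cvg_harmonic.
Unshelve. all: by end_near. Qed.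

(** Naming the generators makes [enlarge F tau t] the sigma-algebra of a measurable
    type, to which the theory of measurable functions applies. *)
Definition enlarge_generators (R : realType) (Omega : Type)
    (F : time R -> set (set Omega)) (tau : Omega -> R) (t : time R) :
    set (set Omega) :=
  F t `|` [set [set w | tau w <= u] | u in
             [set u : R | 0 <= u /\ time_le (at_time u) t]].

Lemma le_enlarge (R : realType) (Omega : Type)
    (F : time R -> set (set Omega)) (tau : Omega -> R) (s t : time R) :
  F s `<=` F t -> time_le s t -> enlarge F tau s `<=` enlarge F tau t.
Proof.
move=> Fst st; apply: sub_sigma_algebra2 => A [FA|[u [u0 us] <-]].
  by left; exact: Fst.
by right; exists u => //; split=> //; exact: time_le_trans us st.
Qed.

Lemma sub_enlarge (R : realType) (Omega : Type)
    (F : time R -> set (set Omega)) (tau : Omega -> R) (t : time R) :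
  F t `<=` enlarge F tau t.
Proof. by move=> A FA; apply: sub_sigma_algebra; left. Qed.

Section progressive.
Context (R : realType) (d : measure_display) (Omega : measurableType d).
Context (F : time R -> set (set Omega)) (tau : Omega -> R).
Context (F_filtration : filtration F) (tau_ge0 : forall w, 0 <= tau w).

(** Whether tau has occurred by time t is known to the enlarged filtration. *)
Lemma adapted_adapted_before (A : time R -> Omega -> R) :
  adapted F A -> adapted_before F tau A.
Proof.
move=> A_adapted t B mB.
have mAB : enlarge F tau t (A t @^-1` B) by apply: sub_enlarge; exact: A_adapted.
case: t mAB => [u|] mAB; last first.
  rewrite [X in enlarge _ _ _ X](_ : _ = A None @^-1` B) //.
  by apply/seteqP; split=> w /= => [[]//|Bw]; split=> //; exact: before_None.
have uE : Some u = at_time (\val u) by rewrite /at_time valK.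
pose S := g_sigma_algebraType (enlarge_generators F tau (Some u)).
have mtau : measurable ([set w | tau w <= \val u] : set S).
  apply: sub_sigma_algebra; right; exists (\val u) => //.
  by split; [exact: (valP u) | rewrite -uE; exact: time_le_refl].
rewrite [X in enlarge _ _ _ X](_ : _ =
    ~` [set w | tau w <= \val u] `&` A (Some u) @^-1` B).
  by apply: (@measurableI _ S) => //; exact: measurableC.
apply/seteqP; split=> w /= [tw Bw]; split=> //.
  by apply/negP; rewrite -ltNge; apply/before_at; rewrite -?uE.
by rewrite uE; apply/before_at => //; rewrite ltNge; apply/negP.
Qed.

Section on_event.
Context (s : R) (s_ge0 : 0 <= s).
Let S := g_sigma_algebraType (enlarge_generators F tau (at_time s)).
Context (E : set S) (mE : measurable E) (tau_le : forall w, E w -> tau w <= s).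

Lemma measurable_tau_le (u : R) : measurable (E `&` [set w | tau w <= u]).
Proof.
have [su|us] := leP s u.
  rewrite (_ : _ `&` _ = E) //; apply/seteqP; split=> w /= => [[]//|Ew].
  by split=> //; exact: le_trans (tau_le Ew) su.
have [u0|u0] := leP 0 u.
  apply: measurableI => //; apply: sub_sigma_algebra; right; exists u => //.
  by split=> //; rewrite time_le_at // ltW.
rewrite (_ : _ `&` _ = set0) //; apply/seteqP; split=> w //= [_].
by rewrite leNgt (lt_le_trans u0).
Qed.

Lemma measurable_grid (k m : nat) :
  measurable (E `&` [set w | grid_index (tau w) k = m]).
Proof.
rewrite (_ : _ `&` _ =
    (E `&` [set w | tau w <= m%:R / k.+1%:R]) `\`
    (E `&` [set w | tau w <= (m%:R - 1) / k.+1%:R])).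
  by apply: measurableD; exact: measurable_tau_le.
apply/seteqP; split=> w /=.
  move=> [Ew /grid_index_eq-/(_ (tau_ge0 w))/andP[lo up]]; split=> // -[_].
  by rewrite leNgt lo.
move=> [[Ew up] nlo]; split=> //; apply/grid_index_eq => //.
by rewrite up andbT ltNge; apply/negP => lo; exact: nlo.
Qed.

(** On each of the countably many cells of the grid the sampling time is constant. *)
Lemma measurable_grid_sample (A : time R -> Omega -> R) (k : nat)
    (rho : nat -> time R) :
    (forall m, measurable_fun (E `&` [set w | grid_index (tau w) k = m])
                 (A (rho m) : S -> R)) ->
  measurable_fun E (fun w : S => A (rho (grid_index (tau w) k)) w).
Proof.
move=> mA.
rewrite (_ : E = \bigcup_m (E `&` [set w | grid_index (tau w) k = m])).
  apply/measurable_fun_bigcup => m; first exact: measurable_grid.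
  apply: eq_measurable_fun (mA m) => w; rewrite inE /= => -[_ ->] //.
apply/seteqP; split=> w; last by case=> m _ [].
by move=> Ew; exists (grid_index (tau w) k).
Qed.

(** The left end of the cell of tau is strictly before tau, so on E it precedes s
    and A is already adapted there; as the mesh shrinks it increases to tau. *)
Lemma measurable_left_limit (A : time R -> Omega -> R) :
    adapted_before F tau A ->
    (forall w, E w -> has_left_limit (A ^~ w) (tau w)) ->
  measurable_fun E (fun w : S => left_limit (A ^~ w) (tau w)).
Proof.
move=> A_adapted A_lim.
pose rho k m : time R := at_time ((m%:R - 1) / k.+1%:R).
apply: (@measurable_fun_cvg _ S R E
    (fun k w => A (rho k (grid_index (tau w) k)) w)); last first.
  move=> w Ew; have /cvg_at_leftP := A_lim w Ew; apply; split.
    by move=> k; have /andP[] := grid_indexP k (tau_ge0 w).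
  exact: grid_cvg.
move=> k; apply: (measurable_grid_sample (rho := rho k)) => m _ B mB.
have [rs|sr] := leP ((m%:R - 1) / k.+1%:R : R) s; last first.
  rewrite (_ : _ `&` _ = set0) //; apply/seteqP; split=> w //= -[[Ew] + _].
  move=> /grid_index_eq-/(_ (tau_ge0 w))/andP[lo _].
  by have := lt_trans (lt_le_trans lo (tau_le Ew)) sr; rewrite ltxx.
have rho_le : time_le (rho k m) (at_time s).
  rewrite /rho; have [r0|r0] := leP 0 ((m%:R - 1) / k.+1%:R : R).
    by rewrite time_le_at.
  by rewrite /at_time insubN // -ltNge.
rewrite (_ : _ `&` _ `&` _ = (E `&` [set w | grid_index (tau w) k = m]) `&`
    [set w | before (tau w) (rho k m) /\ B (A (rho k m) w)]).
  apply: (@measurableI _ S); first exact: measurable_grid.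
  have [_ _ F_mono] := F_filtration.
  by apply: (le_enlarge (F_mono _ _ rho_le) rho_le); exact: A_adapted.
apply/seteqP; split=> w /= -[[Ew gw]] => [Bw|[_ Bw]//]; split=> //; split=> //.
apply/before_at => //.
by move: gw => /grid_index_eq-/(_ (tau_ge0 w))/andP[].
Qed.

(** Right continuity calls for samples strictly after tau; capping them at s keeps
    them within the information available at s, and still gives the right limit
    because on {tau = s} the cap is tau itself. *)
Lemma measurable_value_at (A : time R -> Omega -> R) :
    adapted F A -> (forall w, E w -> cadlag_on setT (A ^~ w)) ->
  measurable_fun E (fun w : S => A (at_time (tau w)) w).
Proof.
move=> A_adapted A_cadlag.
(* m / (k + 1) may equal tau; the next grid point is strictly later. *)
pose rho k m : time R := at_time (Num.min s ((m%:R + 1) / k.+1%:R)).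
apply: (@measurable_fun_cvg _ S R E
    (fun k w => A (rho k (grid_index (tau w) k)) w)); last first.
  move=> w Ew; have := tau_le Ew; rewrite le_eqVlt => /predU1P[tau_s|tau_s].
    apply: cvg_near_cst; near=> k; rewrite /rho -tau_s min_l //.
    have /andP[_ up] := grid_indexP k (tau_ge0 w).
    by apply: (le_trans up); rewrite ler_pM2r ?invr_gt0 ?ltr0n // lerDl.
  have [_ A_right] := A_cadlag w Ew (tau w) (tau_ge0 w) I.
  have /cvg_at_rightP : A (at_time u) w @[u --> (tau w)^'+] -->
      A (at_time (tau w)) w.
    apply: cvg_trans A_right; apply: cvg_app => V; rewrite !nbhs_simpl /within /=.
    by apply: filterS => u; apply.
  apply; split.
    move=> k; rewrite lt_min tau_s /=.
    have /andP[_ up] := grid_indexP k (tau_ge0 w).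
    by apply: (le_lt_trans up); rewrite ltr_pM2r ?invr_gt0 ?ltr0n // ltrDl.
  apply: squeeze_cvgr (cvg_cst (tau w)) (grid_cvg 1 (tau_ge0 w)).
  near=> k; rewrite le_min tau_le //= ge_min lexx orbT andbT.
  have /andP[_ up] := grid_indexP k (tau_ge0 w).
  by apply: (le_trans up); rewrite ler_pM2r ?invr_gt0 ?ltr0n // lerDl.
move=> k; apply: (measurable_grid_sample (rho := rho k)) => m _ B mB.
apply: (@measurableI _ S); first exact: measurable_grid.
apply: sub_enlarge; have [_ _ F_mono] := F_filtration.
apply: (F_mono (rho k m)); last exact: A_adapted.
rewrite /rho time_le_at ?ge_min ?lexx // le_min s_ge0 /=.
by rewrite divr_ge0 // addr_ge0.
Unshelve. all: by end_near. Qed.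

End on_event.
End progressive.

(** * Adaptedness of a continuation at a random time *)

Definition continue_at (R : realType) (Omega : Type) (tau : Omega -> R)
    (A : time R -> Omega -> R) (V : Omega -> R) (t : time R) (w : Omega) : R :=
  if time_lt t (at_time (tau w)) then A t w else V w.

Lemma continue_at_before (R : realType) (Omega : Type) (tau : Omega -> R)
    (A : time R -> Omega -> R) (V : Omega -> R) (t : time R) (w : Omega) :
  before (tau w) t -> continue_at tau A V t w = A t w.
Proof. by rewrite /continue_at /before /= => ->. Qed.

Lemma continue_at_tau (R : realType) (Omega : Type) (tau : Omega -> R)
    (A : time R -> Omega -> R) (V : Omega -> R) (w : Omega) :
  continue_at tau A V (at_time (tau w)) w = V w.
Proof. by rewrite /continue_at /time_lt time_le_refl. Qed.

Lemma continue_at_after (R : realType) (Omega : Type) (tau : Omega -> R)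
    (A : time R -> Omega -> R) (V : Omega -> R) (s : R) (w : Omega) :
  0 <= tau w -> tau w <= s -> continue_at tau A V (at_time s) w = V w.
Proof. by move=> tau0 ts; rewrite /continue_at /time_lt time_le_at // ts. Qed.

Lemma stop_continue_at (R : realType) (Omega : Type) (tau : Omega -> R)
    (A : time R -> Omega -> R) (V : Omega -> R) :
  stop tau (continue_at tau A V) = continue_at tau A V.
Proof.
apply/funext => t; apply/funext => w; rewrite /stop; case: ifPn => // t_gt.
rewrite continue_at_tau /continue_at ifF //; apply/negbTE.
by apply: contra t_gt => /time_ltW.
Qed.

Definition occurred_by (R : realType) (Omega : Type) (G : set Omega)
    (tau : Omega -> R) (s : R) : set Omega :=
  G `&` [set w | tau w <= s].

Section measurable_continuation.
Context (R : realType) (d : measure_display) (Omega : measurableType d).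
Context (P : probability Omega R) (F : time R -> set (set Omega)).
Context (F_filtration : filtration F) (F_usual : usual_hypotheses P F).
Context (tau : Omega -> R) (tau_ge0 : forall w, 0 <= tau w).
Context (tau_meas : measurable_fun setT tau).
Context (G : set Omega) (G_ae : \forall w \ae P, G w).

Local Notation E := (occurred_by G tau).

(** V need only be measurable on the events {tau <= s} within the full event G, where
    it plays the role of a value revealed at tau. *)
Definition terminal_measurable (V : Omega -> R) : Prop :=
  forall s, 0 <= s ->
    measurable_fun (E s : set (g_sigma_algebraType
      (enlarge_generators F tau (at_time s)))) V.

Lemma null_in_filtration (N : set Omega) t : N `<=` ~` G -> F t N.
Proof.
move=> NG; have [_ _ F_mono] := F_filtration; apply: (F_mono None) => //.
apply: F_usual.1; exact: negligibleS NG G_ae.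
Qed.

Lemma measurable_terminal_event s : 0 <= s ->
  measurable (E s : set (g_sigma_algebraType
    (enlarge_generators F tau (at_time s)))).
Proof.
move=> s0; apply: measurableI.
  rewrite -[G]setCK; apply: measurableC.
  by apply: sub_enlarge; exact: null_in_filtration.
apply: sub_sigma_algebra; right; exists s => //.
by split=> //; exact: time_le_refl.
Qed.

(** Before tau the process is A, from tau on it is V, and what happens off G is a
    null set, which belongs to the filtration. *)
Lemma continue_at_adapted (A : time R -> Omega -> R) (V : Omega -> R) :
    adapted_before F tau A -> terminal_measurable V ->
  adapted_upto F tau (continue_at tau A V).
Proof.
move=> A_adapted mV; split=> t B mB.
  rewrite [X in enlarge _ _ _ X](_ : _ =
    [set w | before (tau w) t /\ B (A t w)]); first exact: A_adapted.
  by apply/seteqP; split=> w /= [tw]; rewrite continue_at_before.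
rewrite stop_continue_at; case: t => [u|]; last first.
  rewrite [X in enlarge _ _ _ X](_ : _ =
    [set w | before (tau w) None /\ B (A None w)]); first exact: A_adapted.
  apply/seteqP; split=> w /=; rewrite continue_at_before; try exact: before_None.
    by split=> //; exact: before_None.
  by case.
have [s tE s0] : exists2 s, Some u = at_time s & 0 <= s.
  by exists (\val u); [rewrite /at_time valK | exact: (valP u)].
rewrite tE; pose S := g_sigma_algebraType (enlarge_generators F tau (at_time s)).
rewrite [X in enlarge _ _ _ X](_ : _ =
    [set w | before (tau w) (at_time s) /\ B (A (at_time s) w)]
    `|` (E s `&` V @^-1` B)
    `|` (~` G `&` continue_at tau A V (at_time s) @^-1` B)).
  apply: (@measurableU _ S); first apply: (@measurableU _ S).
  - exact: A_adapted.
  - exact: mV s s0 (measurable_terminal_event s0) B mB.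
  - by apply: sub_enlarge; apply: null_in_filtration => w [].
apply/seteqP; split=> w /=; last first.
  move=> [[|]|[]//]; first by move=> [sT]; rewrite continue_at_before.
  by move=> [[_ ts]]; rewrite continue_at_after.
have [sT|ts] := ltP s (tau w).
  rewrite continue_at_before; first by move=> Bw; left; left; split=> //; exact/before_at.
  exact/before_at.
have [Gw|nGw] := pselect (G w); last by right.
by rewrite continue_at_after // => Bw; left; right.
Qed.

(** G is the countable union of the events {tau <= m} within G, and all subsets of
    its complement are measurable. *)
Lemma terminal_measurable_global (V : Omega -> R) :
  terminal_measurable V -> measurable_fun setT V.
Proof.
move=> mV; have [F_sigma F_meas _] := F_filtration.
have mG : measurable G.
  rewrite -[G]setCK; apply: measurableC.
  by apply: (F_meas None); exact: null_in_filtration.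
have enlarge_meas t A : enlarge F tau t A -> measurable A.
  apply: smallest_sub; first exact: sigma_algebra_measurable.
  move=> _ [/F_meas//|[u _ <-]].
  rewrite -[X in measurable X]setTI; exact: (tau_meas measurableT (measurable_itv `]-oo, u])).
rewrite -(setUv G); apply/(measurable_funU _ mG (measurableC mG)).
split=> [|_ B mB]; last first.
  by apply: (F_meas None); apply: null_in_filtration => w [].
have -> : G = \bigcup_m E m%:R.
  apply/seteqP; split=> w; last by case=> m _ [].
  move=> Gw; exists (Num.truncn (tau w)).+1 => //; split=> //=.
  exact/ltW/truncnS_gt.
apply/measurable_fun_bigcup => m.
  by apply: enlarge_meas (measurable_terminal_event (ler0n R m)).
move=> _ B mB; apply: enlarge_meas (at_time m%:R) _ _.
exact: mV (ler0n R m) (measurable_terminal_event (ler0n R m)) B mB.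
Qed.

Lemma reflect_step_measurable (n : nat) (Q : 'M[R]_n) (p : Omega -> 'cV[R]_n)
    (y : Omega -> 'I_n -> R) :
    (forall i, terminal_measurable (fun w => p w i 0)) ->
    (forall i, terminal_measurable (fun w => y w i)) ->
  forall i, terminal_measurable (fun w => reflect_step Q (p w) (y w) i).
Proof.
move=> mp my i s s0; apply: measurable_maxr; first exact: measurable_cst.
apply: measurable_funB; last exact: mp.
apply: measurable_sum => j; apply: measurable_funM; first exact: measurable_cst.
exact: my.
Qed.

Lemma least_jump_measurable (n : nat) (Q : 'M[R]_n) (p : Omega -> 'cV[R]_n) :
    (forall i j, 0 <= Q i j) ->
    (forall i, terminal_measurable (fun w => p w i 0)) ->
    (forall w, G w -> dual_cone (coneC Q) (p w)) ->
  forall i, terminal_measurable (fun w => least_jump Q (p w) i 0).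
Proof.
move=> Q_ge0 mp pC i s s0.
pose S := g_sigma_algebraType (enlarge_generators F tau (at_time s)).
apply: (@measurable_fun_cvg _ S R (E s) (fun k w => approx_jump Q (p w) k i)).
  move=> k; suff mk j : terminal_measurable (fun w => approx_jump Q (p w) k j).
    exact: mk.
  elim: k j => [|k IHk] j; last exact: reflect_step_measurable.
  by move=> u u0; exact: measurable_cst.
move=> w [Gw _]; have [y yP] := (dual_coneP Q (p w)).1 (pC w Gw).
exact: (@approx_jump_cvg _ _ _ _ Q_ge0 y yP i).
Qed.

End measurable_continuation.

(** * Extension at tau *)

Theorem theorem1 (R : realType) (d : measure_display)
    (Omega : measurableType d) (P : probability Omega R)
    (F : time R -> set (set Omega))
    (F_filtration : filtration F) (F_usual : usual_hypotheses P F)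
    (n : nat) (n_ge1 : (1 <= n)%N)
    (X0 : 'I_n -> Omega -> R)
    (X0_meas : forall i, rv_wrt (F None) (X0 i))
    (X0_ge0 : \forall w \ae P, forall i, 0 <= X0 i w)
    (c : 'I_n -> R) (c_ge0 : forall i, 0 <= c i)
    (Q : 'M[R]_n) (Q_ge0 : forall i j, 0 <= Q i j)
    (Q_diag : forall i, Q i i = 0)
    (Z : 'I_n -> time R -> Omega -> R)
    (Z_adapted : forall i, adapted F (Z i))
    (Z_jump : \forall w \ae P, forall i,
       [/\ cadlag_on setT (path_of Z w i),
           constant_between_jumps (path_of Z w i)
         & finitely_many_jumps (path_of Z w i)])
    (tau : Omega -> R) (tau_meas : measurable_fun setT tau)
    (tau_ge0 : forall w, 0 <= tau w)
    (X L : 'I_n -> time R -> Omega -> R)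
    (XL_solution : solution_before P F c Q X0 Z tau X L)
    (XL_left_limits : \forall w \ae P, forall i,
       has_left_limit (path_of X w i) (tau w) /\
       has_left_limit (path_of L w i) (tau w)) :
  ((exists X' L' : 'I_n -> time R -> Omega -> R,
      extension P F c Q X0 Z tau X L X' L') <->
   (\forall w \ae P, dual_cone (coneC Q) (pre_reflection X Z tau w))) /\
  ((\forall w \ae P, dual_cone (coneC Q) (pre_reflection X Z tau w)) ->
   exists DL : Omega -> 'cV[R]_n,
     [/\ forall i, measurable_fun setT (fun w => DL w i 0),
         exists X' L' : 'I_n -> time R -> Omega -> R,
           extension P F c Q X0 Z tau X L X' L' /\
           \forall w \ae P, forall i,
             L' i (at_time (tau w)) w
             = left_limit (path_of L w i) (tau w) + DL w i 0
       & \forall w \ae P,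
           unique_minimal_in
             (admissible_jump c Q (X0 ^~ w) (path_of Z w) (tau w)
                (path_of X w) (path_of L w))
             (DL w)]).
Proof.
have [XL_adapted sol_ae] := XL_solution.
have Z_cadlag_ae : \forall w \ae P, forall i, cadlag_on setT (path_of Z w i).
  by apply: filterS Z_jump => w Zw i; have [] := Zw i.
have Z_lim w : (forall i, cadlag_on setT (path_of Z w i)) ->
    forall i, has_left_limit (path_of Z w i) (tau w).
  by move=> Zw i; have [] := Zw i (tau w) (tau_ge0 w) I.
suff minimal_extension :
    (\forall w \ae P, dual_cone (coneC Q) (pre_reflection X Z tau w)) ->
    exists DL : Omega -> 'cV[R]_n,
     [/\ forall i, measurable_fun setT (fun w => DL w i 0),
         exists X' L' : 'I_n -> time R -> Omega -> R,
           extension P F c Q X0 Z tau X L X' L' /\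
           \forall w \ae P, forall i,
             L' i (at_time (tau w)) w
             = left_limit (path_of L w i) (tau w) + DL w i 0
       & \forall w \ae P,
           unique_minimal_in
             (admissible_jump c Q (X0 ^~ w) (path_of Z w) (tau w)
                (path_of X w) (path_of L w))
             (DL w)].
  split=> //; split; last first.
    by move=> /minimal_extension[DL [_ [X' [L' [ext _]]] _]]; exists X', L'.
  move=> [X' [L' [[_ sol'_ae] agree_ae]]].
  apply: filterS3 (filterI sol_ae sol'_ae) (filterI agree_ae Z_cadlag_ae)
    XL_left_limits => w [sol sol'] [agree Zw] lims.
  have x_lim i : has_left_limit (path_of X w i) (tau w) by have [] := lims i.
  have l_lim i : has_left_limit (path_of L w i) (tau w) by have [] := lims i.
  apply/dual_coneP; eexists.
  exact: (extension_jump_supersolution (tau_ge0 w) Q_diag sol l_lim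
    (Z_lim w Zw) sol' agree).
move=> dual_ae.
(* Off this event nothing is known about the paths, but its complement is null. *)
pose G : set Omega := [set w |
  [/\ forall i, cadlag_on setT (path_of Z w i),
      path_solution c Q (X0 ^~ w) (path_of Z w) (before (tau w))
        (path_of X w) (path_of L w),
      forall i, has_left_limit (path_of X w i) (tau w) /\
                has_left_limit (path_of L w i) (tau w)
    & dual_cone (coneC Q) (pre_reflection X Z tau w)]].
have G_ae : \forall w \ae P, G w.
  by apply: filterS3 (filterI Z_cadlag_ae sol_ae) XL_left_limits dual_ae
    => w [].
pose DL w := least_jump Q (pre_reflection X Z tau w).
have DL_fix w : G w -> forall i,
    DL w i 0 = reflect_step Q (pre_reflection X Z tau w) (fun j => DL w j 0) i.
  by move=> [_ _ _ /dual_coneP[y yP]]; exact: least_jump_fix yP.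
have XL_meas (A : time R -> Omega -> R) : adapted_before F tau A ->
    (forall w, G w -> has_left_limit (A ^~ w) (tau w)) ->
    terminal_measurable F tau G (fun w => left_limit (A ^~ w) (tau w)).
  move=> A_adapted A_lim s s0; apply: measurable_left_limit => //.
  - exact: (measurable_terminal_event F_filtration F_usual G_ae s0).
  - by move=> w [].
  - by move=> w [/A_lim].
have L_meas i : terminal_measurable F tau G
    (fun w => left_limit (path_of L w i) (tau w)).
  by apply: XL_meas; [have [] := XL_adapted i | move=> w [_ _ /(_ i)[]]].
have p_meas i : terminal_measurable F tau G
    (fun w => pre_reflection X Z tau w i 0).
  rewrite (_ : (fun w => _) = (fun w => left_limit (path_of X w i) (tau w) -
      (Z i (at_time (tau w)) w - left_limit (path_of Z w i) (tau w)))).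
    move=> s s0; apply: measurable_funB.
      by apply: XL_meas => //; [have [] := XL_adapted i | move=> w [_ _ /(_ i)[]]].
    apply: measurable_funB.
      apply: measurable_value_at => //.
      - exact: (measurable_terminal_event F_filtration F_usual G_ae s0).
      - by move=> w [].
      - by move=> w [[Zw _ _ _] _]; exact: Zw.
    apply: XL_meas => //; first exact: adapted_adapted_before.
    by move=> w [/Z_lim Zw _ _ _]; exact: Zw.
  by apply/funext => w; rewrite mxE.
have DL_meas i : terminal_measurable F tau G (fun w => DL w i 0).
  by apply: least_jump_measurable => // w [].
(* X_{tau-} - Delta Z_tau + (I - Q) Delta L_tau, the value that the equation for X
   imposes at tau. *)
pose VX i w := pre_reflection X Z tau w i 0 + DL w i 0 - \sum_j Q i j * DL w j 0.
pose VL i w := left_limit (path_of L w i) (tau w) + DL w i 0.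
pose X' i := continue_at tau (X i) (VX i).
pose L' i := continue_at tau (L i) (VL i).
have agree' w : agree_before (tau w) (path_of X w) (path_of L w)
    (path_of X' w) (path_of L' w).
  by move=> i t tT; rewrite /path_of /X' /L' !continue_at_before.
have sol' w : G w -> path_solution c Q (X0 ^~ w) (path_of Z w) (upto (tau w))
    (path_of X' w) (path_of L' w).
  move=> Gw; have [Zw sol lims _] := Gw.
  have x_lim i : has_left_limit (path_of X w i) (tau w) by have [] := lims i.
  have l_lim i : has_left_limit (path_of L w i) (tau w) by have [] := lims i.
  apply: (fixpoint_extends (tau_ge0 w) Q_diag sol x_lim l_lim (Z_lim w Zw)
    (DL_fix w Gw)).
  - exact: agree'.
  - by move=> i; rewrite /path_of /X' continue_at_tau.
  - by move=> i; rewrite /path_of /L' continue_at_tau.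
exists DL; split.
- move=> i; exact: (terminal_measurable_global F_filtration F_usual tau_meas G_ae
    (DL_meas i)).
- exists X', L'; split; last first.
    by apply: filterE => w i; rewrite /L' continue_at_tau.
  split; last exact: filterE.
  split; last by apply: filterS G_ae; exact: sol'.
  move=> i; have [X_adapted L_adapted] := XL_adapted i.
  split; apply: (continue_at_adapted F_filtration F_usual tau_ge0 G_ae) => //.
    move=> s s0; apply: measurable_funB.
      by apply: measurable_funD; [exact: p_meas | exact: DL_meas].
    apply: measurable_sum => j; apply: measurable_funM; last exact: DL_meas.
    exact: measurable_cst.
  by move=> s s0; apply: measurable_funD; [exact: L_meas | exact: DL_meas].
- apply: filterS G_ae => w Gw; have [Zw sol lims _] := Gw.
  have DL_adm : admissible_jump c Q (X0 ^~ w) (path_of Z w) (tau w)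
      (path_of X w) (path_of L w) (DL w).
    split; first by move=> i; rewrite DL_fix // le_max lexx.
    exists (path_of X' w), (path_of L' w); split=> //; first exact: sol'.
    by move=> i; rewrite /path_of /L' continue_at_tau.
  have DL_least y : admissible_jump c Q (X0 ^~ w) (path_of Z w) (tau w)
      (path_of X w) (path_of L w) y -> forall i, DL w i 0 <= y i 0.
    move=> [_ [x' [l' [sol'' agree'' l'T]]]].
    have super : forall i, reflect_step Q (pre_reflection X Z tau w)
        (fun j => l' j (at_time (tau w)) - left_limit (path_of L w j) (tau w)) i
        <= l' i (at_time (tau w)) - left_limit (path_of L w i) (tau w).
      have l_lim j : has_left_limit (path_of L w j) (tau w) by have [] := lims j.
      exact: (extension_jump_supersolution (tau_ge0 w) Q_diag sol l_lim
        (Z_lim w Zw) sol'' agree'').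
    move=> i; have := least_jump_le Q_ge0 super i.
    by rewrite l'T addrAC subrr add0r.
  have antisym (y : 'cV[R]_n) : (forall i, DL w i 0 <= y i 0) ->
      (forall i, y i 0 <= DL w i 0) -> y = DL w.
    move=> ge le; apply/colP => i; apply/eqP.
    by rewrite eq_le le ge.
  split.
    by split=> // y /DL_least; exact: antisym.
  move=> y [y_adm y_min]; apply/esym/y_min => //.
  exact: DL_least.
Qed.
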